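(* Let $G$ be a finite non-trivial solvable group of derived length $l$. Set $\alpha=\operatorname{rank}(G)$ and $\beta=\operatorname{rank}(G/G')$. For every integer $n\ge \alpha/\beta$ and every generating set $A$ of $G^n$ of minimum size, $$\operatorname{diam}(G^n,A) \le 2\left(4^{l-1} n^l\, |G|+1\right)(n \beta+1)\, n \ln |G|.$$ In particular, if $G$ is a $p$-group, then for every integer $n\ge 1$, $$D(G^n) \le 2\left(4^{l-1}n^l \, |G|+1\right)(n \beta+1)\, n \ln |G|.$$
   Context: $G'$ is the commutator subgroup of $G$, $G^n$ the $n$-th direct power of $G$, and $\operatorname{rank}(G)$ the minimum cardinality of a generating set of $G$. For a finite group $G$ with generating set $A$ and $g\in G$, $l_A(g)$ is the length of a shortest word in the elements of $A$ (no inverses allowed) representing $g$; the identity is represented by the empty word, of length $0$. The diameter is $\operatorname{diam}(G,A)=\max\{l_A(g): g\in G\}$, and $D(G)$ is the maximum of $\operatorname{diam}(G,A)$ over all generating sets $A$ of $G$. The derived length is the least $l$ with $G^{(l)}=\{1\}$, where $G^{(0)}=G$ and $G^{(i+1)}$ is the commutator subgroup of $G^{(i)}$. *)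

(* Defs.v *)
From HB Require Import structures.
From mathcomp Require Import all_boot all_order all_algebra all_fingroup all_solvable.
From mathcomp Require Import reals exp.

Set Implicit Arguments.
Unset Strict Implicit.
Unset Printing Implicit Defensive.

Import GroupScope.

Section Words.

Variable gT : finGroupType.
Implicit Types (A G : {set gT}) (g : gT).

(* No inverses are allowed in a word, and the empty word represents 1. *)
Definition is_word A g (k : nat) : bool :=
  [exists w : k.-tuple gT, all [in A] w && (\prod_(x <- w) x == g)].

Lemma exists_word A g : g \in <<A>> -> exists k, is_word A g k.
Proof.
case/gen_prodgP => k [c cA ->]; exists k.
apply/existsP; exists [tuple c i | i < k]; apply/andP; split.
  by apply/allP => _ /mapP [i _ ->]; exact: cA.
by rewrite big_tuple; apply/eqP/eq_bigr => i _; rewrite tnth_mktuple.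
Qed.

(* The value 0 outside <<A>> is a dummy: there is no word to measure. *)
Definition word_length A g : nat :=
  match @idP (g \in <<A>>) with
  | ReflectT gA => ex_minn (exists_word gA)
  | ReflectF _ => 0
  end.

Definition diam G A : nat := \max_(g in G) word_length A g.

Definition max_diam G : nat := \max_(A : {set gT} | <<A>> == G) diam G A.

Definition has_derived_length G (l : nat) : Prop :=
  G^`(l) = 1 /\ forall k : nat, G^`(k) = 1 -> l <= k.

End Words.

Definition dpower (gT : finGroupType) (G : {group gT}) (n : nat) :
    {group {dffun forall i : 'I_n, gT}} :=
  setXn_group (fun _ : 'I_n => G).

(* Main.v *)
Require Import Defs.
From HB Require Import structures.
From mathcomp Require Import all_boot all_order all_algebra all_fingroup all_solvable.
From mathcomp Require Import reals exp.
From mathcomp Require Import zify ring lra.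

Set Implicit Arguments.
Unset Strict Implicit.
Unset Printing Implicit Defensive.

Import Order.TTheory GRing.Theory Num.Theory.

(* For n > 0 and any generating set, minimal or not, the directed diameter e of G^n
   already satisfies 1 + 2 e <= (2 n)^l #|G|. Put q_i := #|G^(i) : G^(i+1)|.
   Modulo (G^(i+1))^n, the abelian group (G^(i))^n has exponent dividing q_i
   and order q_i^n, so n (q_i - 1) letters suffice. A Schreier argument with
   positive words gives generators of (G')^n of length at most 2 d + 1, where
   d = n (q_0 - 1), hence 1 + 2 e <= \prod_i (1 + 2 n (q_i - 1)). The remaining
   factor of the stated bound is at least 1, because
   ln #|G| >= ln 2 >= 1/2. *)

Section Bounds.

Local Open Scope group_scope.
Implicit Type gT : finGroupType.

(** * Balls of positive words, and Schreier generators *)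

Lemma expsgS gT (B C : {set gT}) k : B \subset C -> B ^+ k \subset C ^+ k.
Proof.
move=> sBC; elim: k => [|k IHk]; first by rewrite !expg0.
by rewrite !expgSr mulgSS.
Qed.

Lemma sub1_expsg gT (A : {set gT}) k : 1 \in (1 |: A) ^+ k.
Proof.
elim: k => [|k IHk]; first by rewrite expg0 inE.
by rewrite expgSr; apply/mulsgP; exists 1 1; rewrite ?setU11 ?mulg1.
Qed.

(** The letter 1 pads short words, so [(1 |: A) ^+ k] is the ball of words in [A] of length at most
    [k]. *)
Lemma leq_expsg gT (A : {set gT}) j k :
  j <= k -> (1 |: A) ^+ j \subset (1 |: A) ^+ k.
Proof.
move=> /subnKC <-; rewrite expgnDr; apply/subsetP => x xj.
by rewrite -[x]mulg1 mem_mulg // sub1_expsg.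
Qed.

Lemma expsg_sub_gen gT (A : {set gT}) k : (1 |: A) ^+ k \subset <<A>>.
Proof.
elim: k => [|k IHk]; first by rewrite expg0 sub1G.
by rewrite expgSr mul_subG // subUset sub1G subset_gen.
Qed.

Lemma expsg_word gT (A : {set gT}) k g :
  g \in (1 |: A) ^+ k -> exists2 j, j <= k & is_word A g j.
Proof.
move=> gk.
suff [s [sk sA <-]] : exists s : seq gT,
    [/\ size s <= k, all [in A] s & \prod_(x <- s) x = g].
  exists (size s) => //; apply/existsP; exists (in_tuple s).
  by rewrite /= sA eqxx.
elim: k g gk => [|k IHk] g; first by rewrite expg0 => /set1gP->;
  exists [::]; rewrite big_nil.
rewrite expgSr => /mulsgP[x y /IHk[s [sk sA <-]] yA ->].
move: yA; rewrite !inE => /orP[/eqP->|yA].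
  by exists s; rewrite mulg1 (leq_trans sk).
by exists (rcons s y); rewrite size_rcons all_rcons yA -cats1 big_cat /= big_seq1.
Qed.

Lemma diam_leq gT (G A : {set gT}) k : G \subset (1 |: A) ^+ k -> diam G A <= k.
Proof.
move=> /subsetP GA; apply/bigmax_leqP => g /GA /expsg_word[j jk wj].
(* Outside [<<A>>] the length is the dummy 0, which is trivially bounded. *)
apply: leq_trans jk; rewrite /word_length; case: {-}_ / idP => // gA.
by case: ex_minnP => m _; apply.
Qed.

(* In a finite group inverses of coset representatives can be replaced by
   positive words: if [w] and [v] are words for the cosets of [b] and
   [b^-1], then [b = (b v) (w v)^-1 w]. *)
Lemma schreier_gen gT (G H : {group gT}) (A : {set gT}) d :
    H <| G -> <<A>> = G -> G \subset (1 |: A) ^+ d * H ->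
  <<H :&: (1 |: A) ^+ d.*2.+1>> = H.
Proof.
move=> nHG genA GdH; set B := 1 |: A; set S := _ :&: _.
have sSH : <<S>> \subset H by rewrite gen_subG subsetIl.
have sBG k : B ^+ k \subset G by rewrite -genA expsg_sub_gen.
apply/eqP; rewrite eqEsubset sSH /=.
(* Right multiplication by a letter preserves [<<S>> * B ^+ d]. Here [c = b * a] has length at most
   [d + 1] and [v] at most [d], so [c * v] fits into [2 d + 1] letters. *)
have step : <<S>> * B ^+ d * B \subset <<S>> * B ^+ d.
  apply/subsetP => _ /mulsgP[_ a /mulsgP[s b sS bB ->] aB ->].
  rewrite -mulgA; set c := b * a.
  have cB : c \in B ^+ d.+1 by rewrite expgSr mem_mulg.
  have cG : c \in G by apply: subsetP (sBG _) _ cB.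
  have /(subsetP GdH)/mulsgP[v h vB hH Ev] : c^-1 \in G by rewrite groupV.
  have /(subsetP GdH)/mulsgP[w h' wB h'H Ew] := cG.
  have vG := subsetP (sBG _) _ vB.
  have cvH : c * v \in H.
    have -> : v = c^-1 * h^-1 by rewrite Ev mulgK.
    by rewrite mulKVg groupV.
  have wvH : w * v \in H.
    have -> : w * v = (c * v) * (h'^-1) ^ v.
      by rewrite conjgE Ew !mulgA mulgK mulgK.
    by rewrite groupM // memJ_norm ?groupV // (subsetP (normal_norm nHG)).
  have cvS : c * v \in <<S>>.
    rewrite mem_gen // inE cvH /= (_ : d.*2.+1 = d.+1 + d).
      by rewrite expgnDr mem_mulg.
    by rewrite -addnn addSn.
  have wvS : w * v \in <<S>>.
    rewrite mem_gen // inE wvH /=; apply: subsetP (leq_expsg A (leqnSn _)) _ _.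
    by rewrite -addnn expgnDr mem_mulg.
  have -> : s * c = (s * (c * v) * (w * v)^-1) * w.
    by rewrite invMg !mulgA mulgK mulgKV.
  by rewrite mem_mulg // groupM ?groupV // groupM.
have GS : G \subset <<S>> * B ^+ d.
  rewrite -genA; have [n ->] := gen_expgs A; rewrite -/B.
  elim: n => [|n IHn].
    rewrite expg0 sub1set; apply/mulsgP.
    by exists 1 1; rewrite ?group1 ?sub1_expsg ?mulg1.
  by rewrite expgSr; apply: subset_trans step; apply: mulSg.
(* If [h = s * b] lies in [H], so does [b], which is then itself a member of [S]. *)
apply/subsetP => h hH.
have /(subsetP GS)/mulsgP[s b sS bB Eh] := subsetP (normal_sub nHG) _ hH.
rewrite Eh groupM // mem_gen // inE; apply/andP; split.
  have -> : b = s^-1 * h by rewrite Eh mulKg.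
  by rewrite groupM ?groupV // (subsetP sSH).
by apply: subsetP bB; apply: leq_expsg; rewrite -addnn -addnS leq_addr.
Qed.

(** * Positive words modulo an abelian layer *)

Lemma expn_bernoulli q k : k <= q -> q.+1 ^ k <= k.+1 * q ^ k.
Proof.
elim: k => [|k IHk] kq; first by [].
rewrite expnS expnS; apply: leq_trans (leq_mul (leqnn _) (IHk (ltnW kq))) _.
rewrite !mulnA leq_mul2r; apply/orP; right.
rewrite mulSn (mulSn k.+1) mulnC; nia.
Qed.

(** Passing from [q] to [q + 1] multiplies the right side by [r] and the left side by
    [(1 + 1/q) ^ (r - 1)], which is at most [r] by [expn_bernoulli]. *)
Lemma leq_expn_swap q r : 0 < r -> r <= q -> q ^ r.-1 <= r ^ q.-1.
Proof.
case: r => // k _ /=; elim: q => // q IHq; rewrite leq_eqVlt => /predU1P[[->]//|].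
rewrite ltnS => kq /=; apply: leq_trans (expn_bernoulli (ltnW kq)) _.
rewrite -[X in (k.+1 ^ X)%N](ltn_predK kq) expnS leq_mul2l /=; exact: IHq.
Qed.

Section AbelianLayer.

Variables (gT : finGroupType) (M N : {group gT}) (A : {set gT}) (q : nat).
Hypotheses (sNM : N \subset M) (derM : M^`(1) \subset N) (genA : <<A>> = M).
Hypotheses (q_gt0 : 0 < q) (expM : {in M, forall x, x ^+ q \in N}).

(* Climbs from [N] to [M] by adjoining elements of [A]; a step of index [r]
   costs [r.-1] letters, and [q ^ r.-1 <= r ^ q.-1] makes the total
   proportional to the logarithm of [#|M : N|]. *)
Lemma abelian_layer_exists :
  exists2 m, q ^ m <= #|M : N| ^ q.-1 & M \subset (1 |: A) ^+ m * N.
Proof.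
have climb (L : {group gT}) : N \subset L -> L \subset M ->
    (exists2 m, q ^ m <= #|L : N| ^ q.-1 & L \subset (1 |: A) ^+ m * N) ->
    exists2 m, q ^ m <= #|M : N| ^ q.-1 & M \subset (1 |: A) ^+ m * N.
  have [k] := ubnP #|M : L|; elim: k L => // k IHk L; rewrite ltnS.
  move=> kL sNL sLM [m qm Lm]; have [sML|nsML] := boolP (M \subset L).
    have EL : (M : {set gT}) = L by apply/eqP; rewrite eqEsubset sML.
    by exists m; rewrite EL.
  have /subsetPn[s sA sL] : ~~ (A \subset L) by rewrite -gen_subG genA.
  have sM : s \in M by rewrite -genA mem_gen.
  have nLM : L <| M by apply: sub_der1_normal => //; apply: subset_trans sNL.
  have nLs : s \in 'N(L) by rewrite (subsetP (normal_norm nLM)).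
  pose L' := (<[s]> <*> L)%G; pose r := #[coset L s].
  have nLcs : <[s]> \subset 'N(L) by rewrite cycle_subG.
  have sLL' : L \subset L' by apply: joing_subr.
  have sL'M : L' \subset M by rewrite join_subG cycle_subG sM.
  have rE : #|L' : L| = r.
    by rewrite -card_quotient ?join_subG ?nLcs ?normG // quotientYidr // quotient_cycle.
  have r_gt0 : 0 < r by apply: order_gt0.
  have srL : s ^+ r \in L.
    by apply: coset_idr; rewrite ?groupX // morphX // expg_order.
  have rq : r <= q.
    apply: dvdn_leq => //; rewrite order_dvdn -morphX //; apply/eqP/coset_id.
    by apply: (subsetP sNL); apply: expM.
  apply: (IHk L') => //=; [|exact: subset_trans sLL'|].
  - apply: leq_trans kL; rewrite -(Lagrange_index sL'M sLL') rE.
    rewrite ltn_Pmulr ?indexg_gt0 // -rE indexg_gt1.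
    by apply: contra sL => /subsetP; apply; rewrite (subsetP (joing_subl _ _)) ?cycle_id.
  - exists (r.-1 + m).
      rewrite -(Lagrange_index sLL' sNL) rE expnD expnMn leq_mul //.
      exact: leq_expn_swap.
    apply/subsetP => _ /[!norm_joinEl] // /mulsgP[_ y /cycleP[i ->] yL ->].
    (* Since [s ^+ r] lies in [L], the full periods of [s ^+ i] can be moved to the right into [L].
       Only [i %% r], at most [r.-1], letters [s] remain. *)
    rewrite (divn_eq i r) mulnC expgnDr expgM.
    set t := (s ^+ r) ^+ _; have tL : t \in L by apply: groupX.
    rewrite (conjgC t) expgnDr -[X in X \in _]mulgA -(mulgA (_ ^+ r.-1)).
    apply: mem_mulg.
      have : s ^+ (i %% r) \in (1 |: A) ^+ (i %% r).
        elim: (i %% r) => [|j IHj]; first by rewrite !expg0 inE.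
        by rewrite !expgSr mem_mulg // !inE sA orbT.
      by apply: subsetP; apply: leq_expsg; rewrite -ltnS (ltn_predK r_gt0) ltn_pmod.
    apply: (subsetP Lm); rewrite groupM // memJ_norm // groupX //.
apply: (climb N) => //; exists 0; first by rewrite indexgg exp1n.
by rewrite expg0 mul1g.
Qed.

Lemma abelian_layer n : #|M : N| = (q ^ n)%N ->
  M \subset (1 |: A) ^+ (n * q.-1) * N.
Proof.
move=> MN; have [m] := abelian_layer_exists; rewrite MN -expnM.
(* Exponents of [q] can be compared only for [q > 1]; for [q = 1] the index is 1 and the empty word
   suffices. *)
case: (ltngtP q 1) q_gt0 => // [q1 _|q1 _ _ _]; last first.
  move: MN; rewrite q1 exp1n => /eqP; rewrite indexg_eq1 => sMN.
  by apply: subset_trans sMN _; rewrite muln0 expg0 mul1g.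
rewrite leq_exp2l // => mn Mm; apply: subset_trans Mm _.
by apply: mulSg; apply: leq_expsg.
Qed.

End AbelianLayer.

(** * Direct powers and induction along the derived series *)

Section DirectPower.

Variables (gT : finGroupType) (n : nat).
Implicit Types G H : {group gT}.

Lemma dpowerP G (x : {dffun forall i : 'I_n, gT}) :
  reflect (forall i, x i \in G) (x \in dpower G n).
Proof. exact: setXnP. Qed.

Lemma card_dpower G : #|dpower G n| = (#|G| ^ n)%N.
Proof. by rewrite /= cardsXn prod_nat_const card_ord. Qed.

Lemma dpowerS G H : H \subset G -> dpower H n \subset dpower G n.
Proof. by move=> sHG; apply: setXnS. Qed.

Lemma index_dpower G H : H \subset G ->
  #|dpower G n : dpower H n| = (#|G : H| ^ n)%N.
Proof.
move=> sHG; apply/eqP; rewrite -(eqn_pmul2l (cardG_gt0 (dpower H n))).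
by rewrite Lagrange ?dpowerS // !card_dpower -expnMn Lagrange.
Qed.

Lemma dpowerXE (x : {dffun forall i : 'I_n, gT}) k i : (x ^+ k) i = x i ^+ k.
Proof. exact: (morphX (dffun_morphism (fun _ : 'I_n => gT) i)). Qed.

Lemma der1_dpower G : (dpower G n)^`(1) \subset dpower G^`(1) n.
Proof.
rewrite gen_subG; apply/subsetP => _ /imset2P[x y /dpowerP xG /dpowerP yG ->].
apply/dpowerP => i; pose f := dffun_morphism (fun _ : 'I_n => gT) i.
have -> : [~ x, y] i = [~ x i, y i] by apply: (morphR f).
exact: mem_commg.
Qed.

(** The induction allows arbitrary generating sets, since the Schreier generators of [(G')^n] need
    not form a minimal one. The strict bound on [e.*2] bounds [1 + 2 e], the quantity that
    multiplies from layer to layer. *)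
Lemma dpower_cover l G (A : {set {dffun forall i : 'I_n, gT}}) :
    0 < n -> G^`(l) = 1 -> <<A>> = dpower G n ->
  exists2 e, e.*2 < (2 * n) ^ l * #|G| & dpower G n \subset (1 |: A) ^+ e.
Proof.
move=> n_gt0; elim: l G A => [|l IHl] G A.
  move=> G1 _; exists 0; first by rewrite expn0 mul1n cardG_gt0.
  rewrite expg0; apply/subsetP => x /dpowerP xG; rewrite inE; apply/eqP/ffunP => i.
  by move: (xG i); rewrite (G1 : (G : {set gT}) = 1) => /set1gP->; rewrite ffunE.
move=> derG genA; pose H := G^`(1)%G; pose q := #|G : H|.
have sHG : H \subset G by apply: der_sub.
have q_gt0 : 0 < q by apply: indexg_gt0.
have dH := der1_dpower G.
have nH : dpower H n <| dpower G n by apply: sub_der1_normal => //; apply: dpowerS.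
have expG : {in dpower G n, forall x, x ^+ q \in dpower H n}.
  move=> x /dpowerP xG; apply/dpowerP => i; rewrite dpowerXE.
  have xN : x i \in 'N(H) by rewrite (subsetP (der_norm 1 G)).
  apply: coset_idr; rewrite ?groupX // morphX //.
  have xGH : coset H (x i) \in G / H by rewrite mem_quotient.
  apply/eqP; rewrite -order_dvdn /q -card_quotient ?der_norm //.
  exact: order_dvdG.
have cover :=
  abelian_layer (dpowerS sHG) dH genA q_gt0 expG (index_dpower sHG).
set d := (n * q.-1)%N in cover.
have derH : H^`(l) = 1.
  by rewrite -derG; elim: (l) => // k IHk; rewrite !dergSn IHk.
have [e eH He] := IHl H _ derH (schreier_gen nH genA cover).
(* Each of the [e] Schreier letters costs [2 d + 1] letters of [A], and [1 + 2 (d + (2 d + 1) e) =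
   (1 + 2 d) (1 + 2 e)]. *)
exists (d + d.*2.+1 * e).
  have Eq : (#|G| = q * #|H|)%N by rewrite mulnC Lagrange.
  have dq : d.*2.+1 <= 2 * n * q.
    by rewrite /d -(prednK q_gt0) /= -mul2n mulnS mulnA; nia.
  rewrite Eq expnS mulnACA.
  apply: leq_trans (leq_mul dq eH); rewrite -!mul2n; nia.
apply: subset_trans cover _; rewrite expgnDr; apply: mulgS.
apply: subset_trans He _; rewrite expgM; apply: expsgS.
by rewrite subUset sub1set sub1_expsg subsetIr.
Qed.

End DirectPower.

Lemma diam_dpower_leq gT n l (G : {group gT}) A :
    0 < n -> G^`(l.+1) = 1 -> <<A>> = dpower G n ->
  diam (dpower G n) A <= 2 ^ l * n ^ l.+1 * #|G|.
Proof.
move=> n_gt0 derG genA; have [e eG cov] := dpower_cover n_gt0 derG genA.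
apply: leq_trans (diam_leq cov) _.
rewrite -leq_double; apply: leq_trans (ltnW eG) _.
by rewrite expnMn expnS -mul2n !mulnA.
Qed.

End Bounds.

(** * Comparison with the logarithmic bound *)

Local Open Scope ring_scope.

Theorem corollary5p22 (R : realType) (gT : finGroupType) (G : {group gT})
    (l alpha beta : nat) :
  (G : {set gT}) <> 1%g ->
  solvable G ->
  has_derived_length G l ->
  alpha = 'm(G)%g ->
  beta = 'm(G / G^`(1))%g ->
  (forall (n : nat) (A : {set {dffun forall i : 'I_n, gT}}),
     alpha%:R / beta%:R <= n%:R :> R ->
     <<A>>%g = dpower G n ->
     #|A| = 'm(dpower G n)%g ->
     (diam (dpower G n) A)%:R <=
       2 * (4 ^+ (l - 1) * n%:R ^+ l * #|G|%:R + 1)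
         * (n%:R * beta%:R + 1) * n%:R * ln (#|G|%:R : R)) /\
  (forall p : nat, prime p -> (p.-group G)%g ->
   forall n : nat, (1 <= n)%N ->
     (max_diam (dpower G n))%:R <=
       2 * (4 ^+ (l - 1) * n%:R ^+ l * #|G|%:R + 1)
         * (n%:R * beta%:R + 1) * n%:R * ln (#|G|%:R : R)).
Proof.
move=> ntG _ [derG _] _ _.
case: l derG => [/ntG//|l derG].
have lnG : 2^-1 <= ln #|G|%:R :> R.
  have G2 : (2 <= #|G|)%N by rewrite cardG_gt1; apply/eqP.
  have ln2 : 2^-1 <= ln (2 : R).
    (* Apply [ln (1 + x) <= x] at [x = - 1/2], using [ln (1/2) = - ln 2]. *)
    have := @le_ln1Dx R (- 2^-1); rewrite (_ : 1 + - 2^-1 = 2^-1); last by field.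
    by rewrite lnV ?posrE // lerN2; apply; lra.
  by apply: le_trans ln2 _; rewrite ler_ln ?posrE ?ltr0n ?ler_nat // ltnW.
have main n (A : {set {dffun forall i : 'I_n, gT}}) : <<A>>%g = dpower G n ->
    (diam (dpower G n) A)%:R <=
       2 * (4 ^+ (l.+1 - 1) * n%:R ^+ l.+1 * #|G|%:R + 1)
         * (n%:R * beta%:R + 1) * n%:R * ln (#|G|%:R : R).
  move=> genA; case: n A genA => [|n] A genA.
    (* For [n = 0] the bound vanishes, but the power is trivial and has diameter 0. *)
    suff : (diam (dpower G 0) A <= 0)%N by rewrite leqn0 mulr0 mul0r => /eqP->.
    by apply: diam_leq; rewrite expg0 -(groupX0 (fun _ => G)).
  have dA := diam_dpower_leq (ltn0Sn n) derG genA.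
  set X := 4 ^+ _ * _ * _; set d : R := (diam _ _)%:R.
  have dX : d <= X.
    apply: (@le_trans _ _ (2 ^ l * n.+1 ^ l.+1 * #|G|)%N%:R); first by rewrite ler_nat.
    rewrite /X subn1 /= -!natrX -!natrM ler_nat.
    by rewrite !leq_mul //; case: (l) => // k; rewrite leq_exp2r.
  have d_ge0 : 0 <= d by apply: ler0n.
  have b_ge1 : 1 <= n.+1%:R * beta%:R + 1 :> R by rewrite lerDr -natrM ler0n.
  have n_ge1 : 1 <= n.+1%:R :> R by rewrite ler1n.
  (* Pairing the 2 with the logarithm makes every factor after [X + 1] at least 1. *)
  have -> : 2 * (X + 1) * (n.+1%:R * beta%:R + 1) * n.+1%:R * ln #|G|%:R
          = (X + 1) * (n.+1%:R * beta%:R + 1) * n.+1%:R * (2 * ln #|G|%:R) by ring.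
  rewrite -[d]mulr1 -[d * 1]mulr1 -[d * 1 * 1]mulr1.
  by rewrite !ler_pM ?mulr_ge0 ?ler01 //; lra.
split=> [n A _ genA _|p _ _ n _]; first exact: main.
rewrite /max_diam; apply: (big_ind (fun d : nat => d%:R <= _)).
(* The maximum starts from 0, so the bound must be nonnegative; [main] for the whole group as
   generating set shows this. *)
- by apply: le_trans (main n (dpower G n) (genGid _)); apply: ler0n.
- by move=> d1 d2; rewrite /maxn; case: ifP.
by move=> A /eqP; apply: main.
Qed.
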